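(* Let $F:\mathbb{R}^n\to\mathbb{R}^m$, let $D\subset\mathbb{R}^m$ be closed, let $\Omega=\{x\in\mathbb{R}^n\mid F(x)\in D\}$, let $\bar x\in\Omega$, let $F$ be continuously differentiable at $\bar x$, and assume that GGCQ holds at $\bar x$. Assume that there exist some (nonempty) convex cone $Q\subset\mathbb{R}^m$ fulfilling $$\widehat N_\Omega(\bar x)\subset\{u\in\mathbb{R}^n\mid\nabla F(\bar x)u\in Q\}^\circ$$ and some cone $\tilde{\mathcal T}\subset\bar{\mathcal T}(Q)$ such that $\widehat N_D(F(\bar x))=\tilde{\mathcal T}^\circ$ and either there is some $u\in\mathbb{R}^n$ with $\nabla F(\bar x)u\in{\rm ri}\,{\rm conv}\,\tilde{\mathcal T}$ or $\tilde{\mathcal T}$ is polyhedral. Then $$\widehat N_\Omega(\bar x)=\nabla F(\bar x)^T\widehat N_D(F(\bar x)).$$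
   Context: A cone is a nonempty set $K$ with $\lambda K\subset K$ for all $\lambda\ge 0$. A cone is called polyhedral here if it is the union of finitely many convex polyhedral cones (it need not be convex). $K^\circ=\{z^*\mid \langle z^*,u\rangle\le 0\ \forall u\in K\}$ is the polar; ${\rm ri}$ is the relative interior. For $\Gamma\subset\mathbb{R}^d$, $\bar z\in\Gamma$: $T_\Gamma(\bar z)=\{u\mid \exists t_k\searrow 0,\ u_k\to u:\ \bar z+t_ku_k\in\Gamma\ \forall k\}$ and $\widehat N_\Gamma(\bar z)=(T_\Gamma(\bar z))^\circ$. GGCQ at $\bar x$: $(T_\Omega(\bar x))^\circ=(T^{\rm lin}_\Omega(\bar x))^\circ$ where $T^{\rm lin}_\Omega(\bar x)=\{u\mid\nabla F(\bar x)u\in T_D(F(\bar x))\}$. For a nonempty convex cone $Q\subset\mathbb{R}^m$, $$\bar{\mathcal T}(Q):=T_D(F(\bar x))\cap\Big(\big({\rm Range}\,\nabla F(\bar x)\cap T_D(F(\bar x))\big)+Q\Big),$$ i.e. the set of all $t\in T_D(F(\bar x))$ for which there are $u\in\mathbb{R}^n$, $q\in Q$ with $\nabla F(\bar x)u=t-q\in T_D(F(\bar x))$. *)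

(* Defs.v *)
From HB Require Import structures.
From mathcomp Require Import all_boot all_order all_algebra.
From mathcomp Require Import all_classical all_reals all_analysis.

Set Implicit Arguments.
Unset Strict Implicit.
Unset Printing Implicit Defensive.

Import Order.TTheory GRing.Theory Num.Theory.
Import numFieldNormedType.Exports.

Local Open Scope classical_set_scope.
Local Open Scope ring_scope.

(* Elements of R^n are row vectors, as in the library's [jacobian]: for a
   differentiable F, [jacobian F x] is the transpose of the usual m x n matrix
   of first partial derivatives. The matrix norm of the
   library is the sup norm, which induces the Euclidean topology. *)

Definition dot (R : realType) (n : nat) (u v : 'rV[R]_n) : R :=
  \sum_(i < n) u 0 i * v 0 i.

Definition grad (R : realType) (n m : nat) (F : 'rV[R]_n -> 'rV[R]_m)
    (x : 'rV[R]_n) (u : 'rV[R]_n) : 'rV[R]_m :=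
  u *m jacobian F x.

Definition gradT (R : realType) (n m : nat) (F : 'rV[R]_n -> 'rV[R]_m)
    (x : 'rV[R]_n) (y : 'rV[R]_m) : 'rV[R]_n :=
  y *m (jacobian F x)^T.

Definition continuously_differentiable_at (R : realType) (n m : nat)
    (F : 'rV[R]_n -> 'rV[R]_m) (x : 'rV[R]_n) : Prop :=
  (\forall y \near x, differentiable F y) /\
  {for x, continuous (jacobian F)}.

Definition is_cone (R : realType) (n : nat) (K : set 'rV[R]_n) : Prop :=
  K !=set0 /\ forall (l : R) (x : 'rV[R]_n), 0 <= l -> K x -> K (l *: x).

Definition polar (R : realType) (n : nat) (K : set 'rV[R]_n) : set 'rV[R]_n :=
  [set z | forall u, K u -> dot z u <= 0].

Definition conv_hull (R : realType) (n : nat) (A : set 'rV[R]_n)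
    : set 'rV[R]_n :=
  smallest (@convex_set R 'rV[R]_n) A.

Definition affine_set (R : realType) (n : nat) (A : set 'rV[R]_n) : Prop :=
  forall (x y : 'rV[R]_n) (l : R), A x -> A y -> A (l *: x + (1 - l) *: y).

Definition aff_hull (R : realType) (n : nat) (A : set 'rV[R]_n)
    : set 'rV[R]_n :=
  smallest (@affine_set R n) A.

Definition relint (R : realType) (n : nat) (A : set 'rV[R]_n)
    : set 'rV[R]_n :=
  [set x | A x /\ \forall y \near x, aff_hull A y -> A y].

Definition convex_polyhedral (R : realType) (n : nat) (A : set 'rV[R]_n)
    : Prop :=
  exists (k : nat) (a : 'I_k -> 'rV[R]_n) (b : 'I_k -> R),
    A = [set x | forall i, dot (a i) x <= b i].

(* A polyhedral cone need not be convex. *)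
Definition polyhedral_cone (R : realType) (n : nat) (K : set 'rV[R]_n)
    : Prop :=
  is_cone K /\
  exists (k : nat) (P : 'I_k -> set 'rV[R]_n),
    (forall i, is_cone (P i) /\ convex_polyhedral (P i)) /\
    K = \bigcup_i P i.

(* The step sizes t_k are positive and tend to 0; requiring them to be
   monotone as well would give the same cone, by passing to a subsequence. *)
Definition tangent_cone (R : realType) (n : nat) (G : set 'rV[R]_n)
    (z : 'rV[R]_n) : set 'rV[R]_n :=
  [set u | exists (t : nat -> R) (v : nat -> 'rV[R]_n),
    [/\ forall k, 0 < t k,
        t @ \oo --> (0 : R),
        v @ \oo --> u &
        forall k, G (z + t k *: v k)]].

Definition regular_normal_cone (R : realType) (n : nat) (G : set 'rV[R]_n)
    (z : 'rV[R]_n) : set 'rV[R]_n :=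
  polar (tangent_cone G z).

Definition linearized_cone (R : realType) (n m : nat)
    (F : 'rV[R]_n -> 'rV[R]_m) (D : set 'rV[R]_m) (x : 'rV[R]_n)
    : set 'rV[R]_n :=
  [set u | tangent_cone D (F x) (grad F x u)].

Definition GGCQ (R : realType) (n m : nat) (F : 'rV[R]_n -> 'rV[R]_m)
    (D : set 'rV[R]_m) (x : 'rV[R]_n) : Prop :=
  polar (tangent_cone (F @^-1` D) x) = polar (linearized_cone F D x).

Definition Tbar (R : realType) (n m : nat) (F : 'rV[R]_n -> 'rV[R]_m)
    (D : set 'rV[R]_m) (x : 'rV[R]_n) (Q : set 'rV[R]_m) : set 'rV[R]_m :=
  tangent_cone D (F x) `&`
  [set v + q | v in range (grad F x) `&` tangent_cone D (F x) & q in Q].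

(* Main.v *)
Require Import Defs.
From HB Require Import structures.
From mathcomp Require Import all_boot all_order all_algebra.
From mathcomp Require Import all_classical all_reals all_analysis.
From mathcomp Require Import ring lra.

Set Implicit Arguments.
Unset Strict Implicit.
Unset Printing Implicit Defensive.

Import Order.TTheory GRing.Theory Num.Theory.
Import numFieldNormedType.Exports.

Local Open Scope classical_set_scope.
Local Open Scope ring_scope.

(** Write [u A] for the derivative at [xbar] applied to [u], [L] for the
    linearized cone and [z] for an element of the regular normal cone of
    [Omega]. By GGCQ that cone is
    the polar of [L], from which the inclusion from right to left is immediate:
    [y A^T] is nonpositive on [L] as soon as [y] is nonpositive on the tangent
    cone of [D].

    For the converse, let [B] be the set of all [u A + q] with [q] in [Q] and
    [dot z u <= 0]. It is a convex cone, and it contains [T]: a point of [Tbar]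
    splits as [u A + q] with [u] in [L], where [z] is nonpositive. Moreover
    [z] is nonpositive at every [u] with [u A] in [B], because [z] is also
    nonpositive on the preimage of [Q]. So [z] is nonpositive at every [u]
    whose image lies in the convex cone generated by [T], and what remains is
    the duality statement that [z = y A^T] for some [y] in the polar of [T].
    It says that the functional [u A |-> dot z u] on the range of [A] extends
    to the whole space and stays nonpositive on [T].

    If the range of [A] meets the relative interior of [conv T], a point of
    the range can be moved slightly beyond, away from any [w] in [conv T].
    Hence every [w] is dominated, in the preorder given by the cone [conv T],
    by a point of the range. This is exactly what M. Riesz' extension theorem
    ([riesz_extension]) requires to extend a functional one dimension at a
    time; the result is [pullback_polar_dominated].

    If [T] is a finite union of polyhedral cones [P i], then a point of their
    sum is a family of points [x i], each subject to finitely many linear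
    inequalities, and [u A = \sum_i x i] is a finite system of linear equations
    in [u] and all the [x i]. Farkas' lemma ([farkas]) for this system yields
    [y] as the vector of multipliers of the equations; the result is
    [pullback_polar_polyhedral]. *)

(** * The dot product *)

Section Dot.
Variables (R : realType) (n : nat).
Implicit Types u v w : 'rV[R]_n.

Lemma dot_scalar u : scalar (dot u).
Proof.
move=> a v w; rewrite /dot mulr_sumr -big_split /=; apply: eq_bigr => i _.
by rewrite !mxE; ring.
Qed.

Lemma dotDr u v w : dot u (v + w) = dot u v + dot u w.
Proof. by have := dot_scalar u 1 v w; rewrite scale1r mul1r. Qed.

Lemma dot0r u : dot u 0 = 0.
Proof. by apply: big1 => i _; rewrite mxE mulr0. Qed.

Lemma dotZr u a v : dot u (a *: v) = a * dot u v.
Proof. by have := dot_scalar u a v 0; rewrite !addr0 dot0r addr0. Qed.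

Lemma dotNr u v : dot u (- v) = - dot u v.
Proof. by rewrite -scaleN1r dotZr mulN1r. Qed.

Lemma dot_inj u v : (forall w, dot u w = dot v w) -> u = v.
Proof.
move=> uv; apply/rowP => i; have := uv (delta_mx 0 i).
rewrite /dot (bigD1 i) //= [RHS](bigD1 i) //= !mxE !eqxx !mulr1.
by rewrite !big1 ?addr0 // => j /negbTE ji; rewrite !mxE ji mulr0.
Qed.

End Dot.

Lemma dot_mulmx (R : realType) (n m : nat) (A : 'M[R]_(n, m))
    (u : 'rV[R]_n) (y : 'rV[R]_m) : dot y (u *m A) = dot (y *m A^T) u.
Proof.
rewrite /dot; under eq_bigr do rewrite mxE mulr_sumr.
rewrite exchange_big /=; apply: eq_bigr => i _; rewrite mxE mulr_suml.
by apply: eq_bigr => j _; rewrite mxE mulrA mulrAC.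
Qed.

(** * Farkas' lemma *)

(** Bartl's induction on the number of inequalities, valid in any vector space
    over an ordered field. If the new inequality [a p] is really used, there is
    a point [x0] satisfying the others with [0 < f x0], hence [0 < a p x0].
    Projecting along [x0] onto the kernel of [a p] reduces to one inequality
    less, and the multiplier of [a p] is then forced by the value of [f] at
    [x0]. *)
Lemma farkas (R : realFieldType) (V : lmodType R) (I : eqType) (s : seq I)
    (a : I -> V -> R) (f : V -> R) :
    uniq s -> (forall i, scalar (a i)) -> scalar f ->
    (forall x, (forall i, i \in s -> a i x <= 0) -> f x <= 0) ->
  exists2 l : I -> R, (forall i, 0 <= l i) &
    forall x, f x = \sum_(i <- s) l i * a i x.
Proof.
have scalar0 (g : V -> R) : scalar g -> g 0 = 0.
  by move=> gs; have := gs (-1) 0 0; rewrite scaler0 addr0 mulN1r addNr.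
elim: s a f => [|p s IHs] a f /=.
  move=> _ _ fs f_le0; exists (fun=> 0) => // x; rewrite big_nil.
  have fx : f x <= 0 by exact: f_le0.
  have : f ((-1) *: x + 0) <= 0 by exact: f_le0.
  rewrite fs scalar0 // => fNx; lra.
move=> /andP[ps us] as_ fs f_le0.
have sE (l l' : I -> R) x : {in s, l =1 l'} ->
    \sum_(i <- s) l i * a i x = \sum_(i <- s) l' i * a i x.
  by move=> ll'; rewrite !big_seq; apply: eq_bigr => i si; rewrite ll'.
have [fs_le0|] :=
    pselect (forall x, (forall i, i \in s -> a i x <= 0) -> f x <= 0).
  have [l l0 fE] := IHs a f us as_ fs fs_le0.
  exists (fun i => if i == p then 0 else l i) => [i|x]; first by case: ifP.
  rewrite big_cons eqxx mul0r add0r fE; apply: sE => i si.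
  by case: eqP => // ip; rewrite -ip si in ps.
move=> /existsNP[x0 /not_implyP[ax0 /negP]]; rewrite -ltNge => fx0.
have px0 : 0 < a p x0.
  rewrite ltNge; apply/negP => px0; move: fx0; rewrite ltNge f_le0 // => i.
  by rewrite inE => /orP[/eqP -> //|]; exact: ax0.
(* [x - c x *: x0] projects [x] along [x0] to the kernel of [a p]. *)
pose c x := a p x / a p x0.
have cs k x y : c (k *: x + y) = k * c x + c y by rewrite /c as_; ring.
have [||x a'x|l l0 fE] := IHs (fun i x => a i x - a i x0 * c x)
    (fun x => f x - f x0 * c x) us.
- by move=> i k x y /=; rewrite as_ cs; ring.
- by move=> k x y /=; rewrite fs cs; ring.
- have shiftE g : scalar g -> g (- c x *: x0 + x) = g x - g x0 * c x.
    by move=> gs; rewrite gs; ring.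
  rewrite -shiftE //; apply: f_le0 => i; rewrite inE => /orP[/eqP ->|si].
    by rewrite shiftE // /c mulrC divfK ?gt_eqF // subrr.
  by rewrite shiftE // a'x.
(* The multiplier that makes the identity exact at [x0]. *)
pose l1 := (f x0 - \sum_(i <- s) l i * a i x0) / a p x0.
exists (fun i => if i == p then l1 else l i) => [i|x].
  case: ifP => // _; apply: divr_ge0; last exact: ltW.
  rewrite subr_ge0 (le_trans _ (ltW fx0)) // big_seq; apply: sumr_le0 => j sj.
  by rewrite mulr_ge0_le0 // ax0.
rewrite big_cons eqxx (sE _ l) => [|i si]; last first.
  by case: eqP => // ip; rewrite -ip si in ps.
have /eqP := fE x; rewrite subr_eq => /eqP ->.
under eq_bigr do rewrite mulrBr mulrA.
rewrite sumrB -mulr_suml /l1 /c; set S1 := \sum_(i <- s) _ .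
by set S2 := \sum_(i <- s) _; ring.
Qed.

(** * Riesz extension of functionals nonpositive on a convex cone *)

Section Riesz.
Variables (R : realType) (W : lmodType R) (C : set W).
Hypothesis CD : forall x y, C x -> C y -> C (x + y).
Hypothesis CZ : forall l x, 0 < l -> C x -> C (l *: x).

(** Adding one direction [v]. By scaling it is enough to control [f x + v] and
    [f x - v] in [C], so [c] has to separate the values of [g] on [dn] from
    those of [- g] on [up]. These are ordered since the sum of a point of [up]
    and one of [dn] has its image in [C]. The domination hypothesis makes [up]
    nonempty as soon as [dn] is, and conversely; this gives the supremum that
    serves as [c] a finite upper bound. *)
Lemma riesz_step (V : lmodType R) (f : V -> W) (g : V -> R) (v : W) :
    linear f -> scalar g ->
    (forall x, C (f x) -> g x <= 0) ->
    (forall w, C w -> exists x, C (f x - w)) ->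
  exists c : R, forall x s, C (f x + s *: v) -> g x + s * c <= 0.
Proof.
move=> fl gs g_le0 fC.
have f0 : f 0 = 0.
  by have := fl (-1) 0 0; rewrite scaler0 addr0 scaleN1r addNr.
have fB x y : f (x - y) = f x - f y.
  by have := fl (-1) y x; rewrite !scaleN1r ![- _ + _]addrC.
have fZ k x : f (k *: x) = k *: f x by rewrite -[k *: x]addr0 fl f0 addr0.
have g0 : g 0 = 0.
  by have := gs (-1) 0 0; rewrite scaler0 addr0 mulN1r addNr.
have gZ k x : g (k *: x) = k * g x by rewrite -[k *: x]addr0 gs g0 addr0.
have gD x y : g (x + y) = g x + g y by rewrite -[x]scale1r gs mul1r scale1r.
pose up := [set x | C (f x + v)]; pose dn := [set x | C (f x - v)].
have updn x y : up x -> dn y -> g y <= - g x.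
  move=> ux dy; rewrite -subr_ge0 -opprD oppr_ge0 -gD; apply: g_le0.
  have := CD ux dy; rewrite addrACA subrr addr0.
  by have := fl 1 x y; rewrite !scale1r => ->.
have scale_up x s : 0 < s -> C (f x + s *: v) -> up (s^-1 *: x).
  move=> s0 Cx; rewrite /up /= fZ -[v](scalerK (lt0r_neq0 s0)) -scalerDr.
  by apply: CZ; rewrite ?invr_gt0.
have scale_dn x s : s < 0 -> C (f x + s *: v) -> dn ((- s)^-1 *: x).
  move=> s0 Cx; rewrite /dn /= fZ; have Ns0 : 0 < - s by rewrite oppr_gt0.
  rewrite -[v](scalerK (lt0r_neq0 Ns0)) -scalerBr scaleNr opprK.
  by apply: CZ; rewrite ?invr_gt0.
have up_dn x : up x -> exists y, dn y.
  by move=> /fC[y]; rewrite opprD addrA -fB => Cy; exists (y - x).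
have dn_up x : dn x -> exists y, up y.
  by move=> /fC[y]; rewrite opprB addrCA addrC -fB => Cy; exists (y - x).
have [[y0 dy0]|ndn] := pselect (exists y, dn y); last first.
  exists 0 => x s Cx; rewrite mulr0 addr0; case: (ltgtP s 0) Cx => [s0|s0|->].
  - by move=> /(scale_dn _ _ s0) dx; case: ndn; eexists; exact: dx.
  - by move=> /(scale_up _ _ s0) /up_dn.
  - by rewrite scale0r addr0; exact: g_le0.
have [x0 ux0] := dn_up _ dy0.
have ubS : ubound (g @` dn) (- g x0) by move=> _ [y dy <-]; exact: updn.
exists (sup (g @` dn)) => x s Cx; case: (ltgtP s 0) Cx => [s0|s0|->].
- move=> /(scale_dn _ _ s0) dx.
  have : g ((- s)^-1 *: x) <= sup (g @` dn).
    by apply: ub_le_sup; [exists (- g x0)|exists ((- s)^-1 *: x)].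
  by rewrite gZ ler_pdivrMl ?oppr_gt0 // mulNr -subr_le0 opprK.
- move=> /(scale_up _ _ s0) ux.
  have : sup (g @` dn) <= - g (s^-1 *: x).
    apply: ge_sup; first by exists (g y0), y0.
    by move=> _ [y dy <-]; exact: updn.
  by rewrite gZ -mulrN ler_pdivlMl // -subr_le0 opprK addrC.
- by rewrite scale0r mul0r !addr0; exact: g_le0.
Qed.

(** The functional is extended along [v 0], then along the other directions
    from the larger space [V * R^o]; this is why [V] and [f] are arbitrary
    rather than a subspace of [W] and its inclusion. *)
Lemma riesz_extension (p : nat) (v : nat -> W) (V : lmodType R) (f : V -> W)
    (g : V -> R) :
    linear f -> scalar g ->
    (forall x, C (f x) -> g x <= 0) ->
    (forall w, C w -> exists x, C (f x - w)) ->
  exists c : nat -> R, forall x (s : nat -> R),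
    C (f x + \sum_(i < p) s i *: v i) -> g x + \sum_(i < p) s i * c i <= 0.
Proof.
elim: p v V f g => [|p IHp] v V f g fl gs g_le0 fC.
  by exists (fun=> 0) => x s; rewrite !big_ord0 !addr0; exact: g_le0.
have [c0 c0P] := riesz_step (v 0) fl gs g_le0 fC.
pose f1 (y : (V * R^o)%type) := f y.1 + y.2 *: v 0.
pose g1 (y : (V * R^o)%type) := g y.1 + y.2 * c0.
have [||y|w Cw|c cP] := IHp (fun i => v i.+1) (V * R^o)%type f1 g1.
- move=> k [x s] [x' s']; rewrite /f1 /= fl !scalerDr scalerDl scalerA.
  by rewrite addrACA.
- by move=> k [x s] [x' s']; rewrite /g1 /= gs /GRing.scale /=; ring.
- exact: c0P.
- have [x Cx] := fC w Cw; exists (x, 0).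
  by rewrite /f1 /= scale0r addr0.
exists (fun i => if i is j.+1 then c j else c0) => x s.
rewrite !big_ord_recl /= !addrA => Cx.
exact: (cP (x, s 0) (fun i => s i.+1)).
Qed.

End Riesz.

(** * The polar of the preimage of a cone *)

Section Pullback.
Variables (R : realType) (n m : nat) (A : 'M[R]_(n, m)).

(** The Riesz extension along all basis vectors provides the coordinates of
    [y], with [dot z u + dot y w <= 0] whenever [u *m A + w] is in [C]. Taking
    [u = 0] places [y] in the polar of [C], and [w = - (u *m A)] identifies
    [z]. *)
Lemma pullback_polar_dominated (C : set 'rV[R]_m) (z : 'rV[R]_n) :
    (forall x y, C x -> C y -> C (x + y)) ->
    (forall l x, 0 < l -> C x -> C (l *: x)) -> C 0 ->
    (forall w, C w -> exists u, C (u *m A - w)) ->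
    (forall u, C (u *m A) -> dot z u <= 0) ->
  exists2 y, polar C y & y *m A^T = z.
Proof.
move=> CD CZ C0 AC z_le0.
pose e i : 'rV[R]_m := \row_j (i == j :> nat)%:R.
have sumE (w : 'rV[R]_m) : exists2 s : nat -> R,
    w = \sum_(i < m) s i *: e i & forall j, w 0 j = s j.
  exists (fun i => if insub i is Some j then w 0 j else 0) => [|j]; last first.
    by rewrite valK.
  apply/rowP => j; rewrite summxE (bigD1 j) //= !mxE eqxx valK mulr1.
  rewrite big1 ?addr0 // => i ij; rewrite !mxE.
  by rewrite (_ : (i == j :> nat) = false) ?mulr0 //; apply/negbTE.
have [||c cP] := riesz_extension CD CZ m e (f := mulmx^~ A) (g := dot z) _ _
    z_le0 AC.
- by move=> k x y; rewrite mulmxDl -scalemxAl.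
- exact: dot_scalar.
pose y : 'rV[R]_m := \row_i c i.
have yP u w : C (u *m A + w) -> dot z u + dot y w <= 0.
  have [s wE ws] := sumE w; rewrite {1}wE => /cP; congr (_ + _ <= _).
  by apply: eq_bigr => i _; rewrite mxE ws mulrC.
exists y => [w Cw|].
  by have := yP 0 w; rewrite mul0mx add0r dot0r add0r; exact.
have yz u : dot z u <= dot (y *m A^T) u.
  by rewrite -dot_mulmx -subr_le0 -dotNr; apply: yP; rewrite subrr.
apply: dot_inj => u; apply/eqP; rewrite eq_le yz andbT.
by have := yz (- u); rewrite !dotNr lerN2.
Qed.

(** Farkas' lemma in the space of pairs [(u, X)], where row [i] of [X] is a
    point of [P i]. The equations [u *m A = \sum_i row i X] are entered as pairs
    of opposite inequalities, and [y] collects the differences of their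
    multipliers. Setting [X = 0] in the resulting identity gives
    [z = y *m A^T]; setting [u = 0] and a single nonzero row gives that [y] is
    nonpositive on [P i]. *)
Lemma pullback_polar_polyhedral (k : nat) (P : 'I_k -> set 'rV[R]_m)
    (z : 'rV[R]_n) :
    (forall i, is_cone (P i) /\ convex_polyhedral (P i)) ->
    (forall u (X : 'M[R]_(k, m)), (forall i, P i (row i X)) ->
      u *m A = \sum_i row i X -> dot z u <= 0) ->
  exists2 y, (forall i, polar (P i) y) & y *m A^T = z.
Proof.
move=> Ppoly z_le0.
(* A polyhedron that is a cone is cut out by the homogeneous inequalities. *)
have /choice[a aP] : forall i, exists a : {p : nat & 'I_p -> 'rV[R]_m},
    P i = [set x | forall j, dot (tagged a j) x <= 0].
  move=> i; have [[[x0 Px0] Pcone] [p [a [b PE]]]] := Ppoly i.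
  exists (existT _ p a); apply/seteqP; split=> x /=; last first.
    have := Pcone 0 x0 (lexx 0) Px0; rewrite scale0r PE => b_ge0 ax j.
    by apply: le_trans (ax j) _; have := b_ge0 j; rewrite dot0r.
  move=> Px j; rewrite leNgt; apply/negP => ax0.
  (* Scaled by [t], the point [x] would violate the inequality with [b j]. *)
  pose t := (`|b j| + 1) / dot (a j) x.
  have t0 : 0 <= t by rewrite divr_ge0 ?addr_ge0 // ltW.
  have := Pcone t x t0 Px; rewrite PE => /(_ j).
  rewrite dotZr /t divfK ?gt_eqF // => bj.
  by have := ler_norm (b j); lra.
pose J := {i : 'I_k & 'I_(tag (a i))}.
pose eqn (y : ('rV[R]_n * 'M[R]_(k, m))%type) := y.1 *m A - \sum_i row i y.2.
have eqnl : linear eqn.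
  move=> c [u X] [u' X']; rewrite /eqn /= mulmxDl -scalemxAl.
  under eq_bigr do rewrite linearP.
  by rewrite big_split /= -scaler_sumr opprD scalerBr addrACA.
pose con (t : J + ('I_m + 'I_m)) (y : ('rV[R]_n * 'M[R]_(k, m))%type) : R :=
  match t with
  | inl t => dot (tagged (a (tag t)) (tagged t)) (row (tag t) y.2)
  | inr (inl j) => eqn y 0 j
  | inr (inr j) => - eqn y 0 j
  end.
have [|||y ycon|l l_ge0 zE] :=
  @farkas R _ _ (index_enum (J + ('I_m + 'I_m))%type) con
    (fun y : ('rV[R]_n * 'M[R]_(k, m))%type => dot z y.1).
- exact: index_enum_uniq.
- move=> [t|[j|j]] c y y' /=.
  + by rewrite !linearP /= dot_scalar.
  + by rewrite eqnl !mxE.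
  + by rewrite eqnl !mxE; ring.
- by move=> c [u X] [u' X'] /=; rewrite dot_scalar.
- apply: (z_le0 y.1 y.2) => [i|].
    rewrite aP => j; apply: (ycon (inl (existT _ i j))).
    exact: mem_index_enum.
  apply/eqP; rewrite -subr_eq0; apply/eqP/rowP => j; rewrite [RHS]mxE.
  apply/eqP; rewrite eq_le (ycon (inr (inl j))) ?mem_index_enum //=.
  by rewrite -oppr_le0 (ycon (inr (inr j))) ?mem_index_enum.
pose y := \row_j (l (inr (inl j)) - l (inr (inr j))).
have {}zE u X : dot z u = dot y (u *m A - \sum_i row i X) +
    \sum_t l (inl t) * dot (tagged (a (tag t)) (tagged t)) (row (tag t) X).
  rewrite (zE (u, X)) !big_sumType /= addrC -big_split /=; congr (_ + _).
  by apply: eq_bigr => j _; rewrite /eqn /y [in RHS]mxE /=; ring.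
exists y => [i x Px|].
  pose X := \matrix_(i', j) (if i' == i then x 0 j else 0).
  have rowX i' : row i' X = if i' == i then x else 0.
    by apply/rowP => j; rewrite !mxE; case: ifP; rewrite ?mxE.
  have XE : \sum_i' row i' X = x.
    rewrite (bigD1 i) //= rowX eqxx big1 ?addr0 // => i' /negbTE i'i.
    by rewrite rowX i'i.
  have := zE 0 X; rewrite dot0r mul0mx sub0r XE dotNr => /eqP.
  rewrite eq_sym addrC subr_eq0 => /eqP <-; apply: sumr_le0 => -[i' j] _ /=.
  apply: mulr_ge0_le0 => //; rewrite rowX; case: eqP => [i'i|_].
    by move: Px; rewrite -i'i aP; exact.
  by rewrite dot0r.
apply: dot_inj => u; have := zE u 0.
under eq_bigr do rewrite linear0; rewrite big1 // subr0.
under eq_bigr do rewrite linear0 dot0r mulr0; rewrite big1 // addr0.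
by rewrite dot_mulmx.
Qed.

End Pullback.

(** * Convex cones and relative interiors *)

Lemma convexP (R : realType) (n : nat) (A : set 'rV[R]_n) :
  @convex_set R 'rV[R]_n A <->
  forall (x y : 'rV[R]_n) l, 0 <= l -> l <= 1 -> A x -> A y ->
    A (l *: x + (1 - l) *: y).
Proof.
split=> [Ac x y l l0 l1 Ax Ay|Ac x y l].
  have := @Ac x y (Itv01 l0 l1); rewrite !inE; exact.
by rewrite !inE => Ax Ay; apply: Ac.
Qed.

Lemma convex_coneD (R : realType) (n : nat) (A : set 'rV[R]_n) :
    @convex_set R 'rV[R]_n A -> (forall l x, 0 <= l -> A x -> A (l *: x)) ->
  forall x y, A x -> A y -> A (x + y).
Proof.
move=> /convexP Ac AZ x y Ax Ay.
have h : A (2^-1 *: x + (1 - 2^-1) *: y) by apply: Ac => //; lra.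
rewrite (_ : x + y = 2 *: (2^-1 *: x + (1 - 2^-1) *: y)); first exact: AZ.
by apply/rowP => j; rewrite !mxE; field.
Qed.

Section ConvHull.
Variables (R : realType) (n : nat) (T : set 'rV[R]_n).
Hypothesis coneT : is_cone T.

Lemma conv_hullZ l x : 0 <= l -> conv_hull T x -> conv_hull T (l *: x).
Proof.
move=> l0.
suff /[apply] : conv_hull T `<=` [set x | conv_hull T (l *: x)] by [].
apply: smallest_sub => [|y Ty]; last first.
  by apply: sub_gen_smallest; apply: coneT.2.
apply/convexP => y w k k0 k1 /= Ty Tw B [Bc TB].
rewrite scalerDr !scalerA ![l * _]mulrC -!scalerA.
by apply: (convexP B).1 => //; [apply: Ty|apply: Tw]; split.
Qed.

Lemma conv_hullD x y : conv_hull T x -> conv_hull T y -> conv_hull T (x + y).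
Proof.
apply: convex_coneD; last by move=> l z; exact: conv_hullZ.
apply/convexP => u w k k0 k1 Tu Tw B [Bc TB].
by apply: (convexP B).1 => //; [apply: Tu|apply: Tw]; split.
Qed.

Lemma conv_hull0 : conv_hull T 0.
Proof.
have [x Tx] := coneT.1; rewrite -(scale0r x).
by apply: conv_hullZ => //; exact: sub_gen_smallest.
Qed.

End ConvHull.

(** The point [x + e *: (x - w)] lies on the line through [x] and [w], hence in
    the affine hull of [C], and it is close to [x] when [e] is small. *)
Lemma relint_extend (R : realType) (n : nat) (C : set 'rV[R]_n)
    (x w : 'rV[R]_n) :
  relint C x -> C w -> exists2 e : R, 0 < e & C (x + e *: (x - w)).
Proof.
move=> [Cx xC] Cw.
have xe : x + e *: (x - w) @[e --> (0 : R)^'+] --> x.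
  have xE : x + 0 *: (x - w) = x by rewrite scale0r addr0.
  rewrite -[X in _ --> X]xE; apply: cvg_at_right_filter.
  by apply: cvgD; [exact: cvg_cst|exact: scalel_continuous].
have {}xe := xe _ xC.
near (0 : R)^'+ => e; exists e; first by near: e; exact: nbhs_right_gt.
have : aff_hull C (x + e *: (x - w)) -> C (x + e *: (x - w)) by near: e.
apply => B [Baff CB].
rewrite (_ : _ + _ = (1 + e) *: x + (1 - (1 + e)) *: w).
  by apply: Baff; exact: CB.
by apply/rowP => j; rewrite !mxE; ring.
Unshelve. all: by end_near. Qed.

(** * The regular normal cone of the feasible set *)

Theorem corollary4 (R : realType) (n m : nat) (F : 'rV[R]_n -> 'rV[R]_m)
    (D : set 'rV[R]_m) (Omega : set 'rV[R]_n) (xbar : 'rV[R]_n)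
    (closedD : closed D)
    (defOmega : Omega = [set x | D (F x)])
    (xbarOmega : Omega xbar)
    (dF : continuously_differentiable_at F xbar)
    (ggcq : GGCQ F D xbar)
    (exQT : exists Q : set 'rV[R]_m,
      [/\ is_cone Q,
          convex_set Q,
          regular_normal_cone Omega xbar `<=`
            polar [set u : 'rV[R]_n | Q (grad F xbar u)] &
          exists T : set 'rV[R]_m,
            [/\ is_cone T,
                T `<=` Tbar F D xbar Q,
                regular_normal_cone D (F xbar) = polar T &
                (exists u : 'rV[R]_n, relint (conv_hull T) (grad F xbar u)) \/
                polyhedral_cone T]]) :
  regular_normal_cone Omega xbar =
    gradT F xbar @` regular_normal_cone D (F xbar).
Proof.
have NE : regular_normal_cone Omega xbar = polar (linearized_cone F D xbar).
  by rewrite /regular_normal_cone defOmega; exact: ggcq.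
have [Q [Qcone Qconv NQ [T [Tcone TQ NT cases]]]] := exQT.
apply/seteqP; split; last first.
  move=> _ [y yN <-]; rewrite NE => u Lu.
  by rewrite /gradT -dot_mulmx; exact: yN.
move=> z zN; set A := jacobian F xbar.
have QD : forall x y, Q x -> Q y -> Q (x + y).
  by apply: convex_coneD => // l x; exact: Qcone.2.
pose B := [set t | exists2 u, dot z u <= 0 & Q (t - u *m A)].
have TB : T `<=` B.
  move=> t /TQ[_ [_ [[u _ <-] Du] [q Qq <-]]]; exists u.
    by move: zN; rewrite NE; exact.
  by rewrite addrAC subrr add0r.
have BD x y : B x -> B y -> B (x + y).
  move=> [u zu Qu] [v zv Qv]; exists (u + v); first by rewrite dotDr; lra.
  by rewrite mulmxDl opprD addrACA; exact: QD.
have BZ l x : 0 <= l -> B x -> B (l *: x).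
  move=> l0 [u zu Qu]; exists (l *: u); first by rewrite dotZr mulr_ge0_le0.
  by rewrite -scalemxAl -scalerBr; exact: Qcone.2.
have zB u : B (u *m A) -> dot z u <= 0.
  move=> [v zv]; rewrite -mulmxBl => /(NQ z zN); rewrite dotDr dotNr; lra.
rewrite NT; case: cases => [[u0 Tu0]|[_ [k [P [Ppoly TE]]]]].
  have convB : conv_hull T `<=` B.
    apply: smallest_sub => //; apply/convexP => x y l l0 l1 Bx By.
    by apply: BD; apply: BZ; rewrite ?subr_ge0.
  have [|||w Tw|u Tu|y yT yz] :=
      @pullback_polar_dominated _ _ _ A (conv_hull T) z.
  - exact: conv_hullD.
  - by move=> l x /ltW; exact: conv_hullZ.
  - exact: conv_hull0.
  - have [e e0 Te] := relint_extend Tu0 Tw.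
    (* Dividing [(1 + e) u0 A - e w] by [e] bounds [w] by a range vector. *)
    exists ((e^-1 * (1 + e)) *: u0); rewrite -scalemxAl.
    have ei : 0 <= e^-1 by rewrite invr_ge0 ltW.
    have := conv_hullZ Tcone ei Te; congr conv_hull.
    apply/rowP => j; rewrite !mxE /grad; field; exact: lt0r_neq0.
  - by apply: zB; exact: convB.
  exists y => // t Tt; apply: yT; exact: sub_gen_smallest.
have [u X PX uX|y yP yz] := pullback_polar_polyhedral Ppoly (z := z) (A := A).
  apply: zB; rewrite uX; elim/big_ind: _ => [||i _]; [|exact: BD|].
    have [q Qq] := Qcone.1; exists 0; first by rewrite dot0r.
    by rewrite mul0mx subr0 -(scale0r q); exact: Qcone.2.
  by apply: TB; rewrite TE; exists i.
by exists y => // t; rewrite TE => -[i _]; exact: yP.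
Qed.
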